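(* Let $d\in\{2,3,\dots,9\}$ and $n\geq 2$ be integers, let $E=\binom{[n]}{2}$ be the set of $2$-element subsets of $[n]=\{1,\dots,n\}$ and $m=|E|=\binom{n}{2}$. Then the polynomial $$f_d(x)=\sum_{(e_1,\ldots,e_d)\in E^d}\prod_{i=1}^d \frac{x_{e_i}}{|e_1\cup\cdots\cup e_i|}$$ in the variables $x=(x_e)_{e\in E}$ is convex over the standard simplex $\Delta_m=\{x\in\mathbb{R}^E: x\geq 0,\ \sum_{e\in E}x_e=1\}$.
   Context: This is the case $L=2$ (edges of the complete graph on $n$ vertices) of the polynomial $f_d$; the statement holds for every $n\ge 2$. *)

(* Defs.v *)
From mathcomp Require Export all_boot all_order all_algebra.
From mathcomp Require Export classical_sets reals convex.

Set Implicit Arguments.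
Unset Strict Implicit.
Unset Printing Implicit Defensive.

Import GRing.Theory Num.Theory.

Local Open Scope ring_scope.

(* The vertex set [n] = {1, ..., n} is represented by 'I_n. *)
Notation edge n := {e : {set 'I_n} | #|e| == 2%N}.

Lemma card_edge (n : nat) : #|{: edge n}| = 'C(n, 2).
Proof. by rewrite card_sig -[in RHS](card_ord n) -card_draws cardsE. Qed.

(* The cardinality |e_1 \cup ... \cup e_i| of the union up to and including
   e_i; tuples are indexed from 0. *)
Definition union_card (n d : nat) (e : {ffun 'I_d -> edge n}) (i : 'I_d) : nat :=
  #|(\bigcup_(j < d | (j <= i)%N) val (e j))%SET|.

Definition fd (R : realType) (n d : nat) (x : {ffun edge n -> R^o}) : R^o :=
  \sum_(e : {ffun 'I_d -> edge n})
    \prod_(i < d) (x (e i) / (union_card e i)%:R).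

Definition simplex (R : realType) (n : nat) : set {ffun edge n -> R^o} :=
  [set x | (forall e, 0 <= x e) /\ \sum_e x e = 1]%classic.

Arguments fd : clear implicits.
Arguments simplex : clear implicits.

(* Main.v *)
Require Import Defs.
From mathcomp Require Import interval_inference ring lra polyrcf.

(** With [tau_v] independent exponential variables of mean 1,
      [fd x = E[(\sum_e x_e * min_(v in e) tau_v)^d] / d!],
    an average of [d]-th powers of nonnegative linear forms, hence convex on
    the nonnegative orthant. The proof replaces the expectation by the algebraic
    recursion it satisfies (condition on the smallest [tau_v]): if [F S d] is the
    part of [fd] supported on edges inside [S], then
      [#|S| F S (d+1) = (\sum_(e inside S) x_e) F S d
                        + \sum_(v in S) F (S minus v) (d+1)].
    For the restriction of [F] to a line, this recursion propagates the
    nonnegativity of [E[U^d (Z + c)^2] / d! = F''(d+2) + 2 c F'(d+1) + c^2 F(d)],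
    [U] being the linear form at the current point and [Z] its derivative. *)

Set Implicit Arguments.
Unset Strict Implicit.
Unset Printing Implicit Defensive.

Import Order.TTheory GRing.Theory Num.Theory.

Local Open Scope ring_scope.

(** * Appending a last edge to a word of edges *)

Definition ffun_rcons (T : Type) d (p : {ffun 'I_d -> T} * T) :
    {ffun 'I_d.+1 -> T} :=
  [ffun i => oapp p.1 p.2 (unlift ord_max i)].

Lemma ffun_rcons_lift (T : Type) d (p : {ffun 'I_d -> T} * T) i :
  ffun_rcons p (lift ord_max i) = p.1 i.
Proof. by rewrite ffunE liftK. Qed.

Lemma ffun_rcons_widen (T : Type) d (p : {ffun 'I_d -> T} * T) i :
  ffun_rcons p (widen_ord (leqnSn d) i) = p.1 i.
Proof.
rewrite -ffun_rcons_lift; congr (ffun_rcons p _).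
by apply/val_inj; rewrite [RHS]lift_max.
Qed.

Lemma ffun_rcons_max (T : Type) d (p : {ffun 'I_d -> T} * T) :
  ffun_rcons p ord_max = p.2.
Proof. by rewrite ffunE unlift_none. Qed.

Lemma ffun_rcons_bij (T : Type) d : bijective (@ffun_rcons T d).
Proof.
exists (fun e : {ffun _ -> T} => ([ffun i => e (lift ord_max i)], e ord_max)) => [[e a]|e].
  rewrite ffun_rcons_max; congr pair.
  by apply/ffunP => i; rewrite ffunE ffun_rcons_lift.
by apply/ffunP => i; rewrite ffunE; case: unliftP => [j|] -> //=; rewrite ffunE.
Qed.

Section EdgeWords.
Variable n : nat.

Definition vertices d (e : {ffun 'I_d -> edge n}) : {set 'I_n} :=
  \bigcup_i val (e i).

Lemma vertices_rcons d (p : {ffun 'I_d -> edge n} * edge n) :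
  vertices (ffun_rcons p) = vertices p.1 :|: val p.2.
Proof.
rewrite /vertices big_ord_recr /= ffun_rcons_max; congr (_ :|: _).
by apply: eq_bigr => i _; rewrite ffun_rcons_widen.
Qed.

Lemma union_card_rcons d (p : {ffun 'I_d -> edge n} * edge n) i :
  union_card (ffun_rcons p) (widen_ord (leqnSn d) i) = union_card p.1 i.
Proof.
rewrite /union_card big_mkcond big_ord_recr /= leqNgt ltn_ord /= finset.setU0.
rewrite -big_mkcond /=; congr #|pred_of_set _|.
by apply: eq_bigr => j _; rewrite ffun_rcons_widen.
Qed.

Lemma union_card_max d (e : {ffun 'I_d.+1 -> edge n}) :
  union_card e ord_max = #|vertices e|.
Proof.
congr #|pred_of_set _|; apply: eq_bigl => j.
by rewrite /= -ltnS ltn_ord.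
Qed.

Lemma vertices_gt0 d (e : {ffun 'I_d.+1 -> edge n}) : (0 < #|vertices e|)%N.
Proof.
apply: (@leq_trans #|val (e ord_max)|); first by rewrite (eqP (valP (e _))).
exact/subset_leq_card/(finset.bigcup_sup ord_max).
Qed.

End EdgeWords.

(** * The recursion on the vertex set and the length *)

Section Recursion.
Variables (K : numFieldType) (n : nat) (A : comAlgType K) (g : edge n -> A).
Implicit Types (S : {set 'I_n}) (d : nat).

(** Values in an algebra [A] allow [g] to be polynomial-valued, so that the recursion also governs
    restrictions to lines. *)
Definition word_weight d (e : {ffun 'I_d -> edge n}) : A :=
  (\prod_i (union_card e i)%:R^-1 : K) *: \prod_i g (e i).

Definition word_sum S d : A :=
  \sum_(e : {ffun 'I_d -> edge n} | vertices e \subset S) word_weight e.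

(** The last union is the whole vertex set of the word, so the factor in front cancels the last
    denominator. *)
Lemma word_weight_rcons d (p : {ffun 'I_d -> edge n} * edge n) :
  #|vertices (ffun_rcons p)|%:R *: word_weight (ffun_rcons p) =
  g p.2 * word_weight p.1.
Proof.
rewrite /word_weight !big_ord_recr /= union_card_max ffun_rcons_max.
rewrite scalerA mulrCA divff ?mulr1; last first.
  by rewrite pnatr_eq0 -lt0n vertices_gt0.
rewrite [g p.2 * _]mulrC -scalerAl; congr (_ *: (_ * _)).
  by apply: eq_bigr => i _; rewrite union_card_rcons.
by apply: eq_bigr => i _; rewrite ffun_rcons_widen.
Qed.

Lemma word_sum_rcons S d :
  \sum_(e : {ffun 'I_d.+1 -> edge n} | vertices e \subset S)
     #|vertices e|%:R *: word_weight e =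
  (\sum_(a : edge n | val a \subset S) g a) * word_sum S d.
Proof.
rewrite (reindex (@ffun_rcons (edge n) d)); last exact/onW_bij/ffun_rcons_bij.
rewrite mulrC /word_sum big_distrlr /= pair_big /=.
apply: eq_big => [p|p _]; first by rewrite vertices_rcons finset.subUset.
by rewrite word_weight_rcons mulrC.
Qed.

(** Double counting: a word inside [S] survives the removal of [v] exactly when [v] lies in [S] off
    its vertices. *)
Lemma word_sum_setD1 S d :
  \sum_(v in S) word_sum (S :\ v) d =
  \sum_(e : {ffun 'I_d -> edge n} | vertices e \subset S)
     (#|S| - #|vertices e|)%:R *: word_weight e.
Proof.
rewrite /word_sum (exchange_big_dep (fun e => vertices e \subset S)) /=; last first.
  by move=> v e _; rewrite finset.subsetD1 => /andP[].
apply: eq_bigr => e eS; rewrite scaler_nat -cardsDS // -sumr_const.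
by apply: eq_bigl => v; rewrite finset.subsetD1 eS inE andbC.
Qed.

Lemma word_sum_rec S d :
  #|S|%:R *: word_sum S d.+1 =
  (\sum_(a : edge n | val a \subset S) g a) * word_sum S d +
  \sum_(v in S) word_sum (S :\ v) d.+1.
Proof.
rewrite -word_sum_rcons word_sum_setD1 -big_split scaler_sumr /=.
by apply: eq_bigr => e eS; rewrite -scalerDl -natrD subnKC // subset_leq_card.
Qed.

Lemma word_sum0 S : word_sum S 0 = 1.
Proof.
pose e0 : {ffun 'I_0 -> edge n} := ffun0 (card_ord 0).
have e0P e : e = e0 by apply/ffunP => -[].
rewrite /word_sum (big_pred1 e0) => [|e].
  by rewrite /word_weight !big_ord0 scale1r.
by rewrite /vertices big_ord0 finset.sub0set /= (e0P e) eqxx.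
Qed.

Lemma word_sum_set0 d : word_sum finset.set0 d.+1 = 0.
Proof.
rewrite /word_sum big_pred0 // => e; rewrite finset.subset0 -cards_eq0.
exact/gtn_eqF/vertices_gt0.
Qed.

End Recursion.

(** After multiplication by [s], the shift to [c'] absorbs the cross terms in [z]; what remains
    beside the [Q] and [T] forms is [z ^+ 2 / s * P0]. *)
Lemma complete_square (K : realFieldType) (s u z c P2 P1 P0 Q2 Q1 Q0 T2 T1 T0 : K)
    (c' := c + z / s) :
  0 < s -> 0 <= u ->
  s * P2 = 2 * z * P1 + u * Q2 + T2 ->
  s * P1 = z * P0 + u * Q1 + T1 ->
  s * P0 = u * Q0 + T0 ->
  0 <= P0 -> 0 <= Q2 + 2 * c' * Q1 + c' ^+ 2 * Q0 ->
  0 <= T2 + 2 * c' * T1 + c' ^+ 2 * T0 ->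
  0 <= P2 + 2 * c * P1 + c ^+ 2 * P0.
Proof.
move=> s0 u0 e2 e1 e0 P0_ge0 Q_ge0 T_ge0; rewrite -(pmulr_rge0 _ s0).
have -> : s * (P2 + 2 * c * P1 + c ^+ 2 * P0) =
    z ^+ 2 / s * P0 + u * (Q2 + 2 * c' * Q1 + c' ^+ 2 * Q0) +
    (T2 + 2 * c' * T1 + c' ^+ 2 * T0).
  have -> : T2 = s * P2 - (2 * z * P1 + u * Q2) by rewrite e2; ring.
  have -> : T1 = s * P1 - (z * P0 + u * Q1) by rewrite e1; ring.
  have -> : T0 = s * P0 - u * Q0 by rewrite e0; ring.
  by rewrite /c'; field; rewrite lt0r_neq0.
apply: addr_ge0 => //; apply: addr_ge0; rewrite mulr_ge0 //.
by rewrite divr_ge0 ?sqr_ge0 // ltW.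
Qed.

(** * Restriction to a line and its derivatives *)

Section Line.
Variables (K : realFieldType) (n : nat) (y z : edge n -> K).
Implicit Types (S : {set 'I_n}) (d : nat) (c t : K).

Definition line_sum S d : {poly K} := word_sum (fun a => (y a)%:P + z a *: 'X) S d.

Let Y S : K := \sum_(a : edge n | val a \subset S) y a.
Let Z S : K := \sum_(a : edge n | val a \subset S) z a.

Lemma line_sum_rec S d :
  #|S|%:R *: line_sum S d.+1 =
  ((Y S)%:P + Z S *: 'X) * line_sum S d + \sum_(v in S) line_sum (S :\ v) d.+1.
Proof.
rewrite /line_sum word_sum_rec; congr (_ * _ + _).
by rewrite big_split /= rmorph_sum scaler_suml.
Qed.

Lemma horner_line_sum_rec S d t :
  #|S|%:R * (line_sum S d.+1).[t] =
  (Y S + t * Z S) * (line_sum S d).[t] + \sum_(v in S) (line_sum (S :\ v) d.+1).[t].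
Proof.
have /(congr1 (horner^~ t)) := line_sum_rec S d.
by rewrite !hornerE [(\sum_(v in S) _).[t]]horner_sum [Z S * t]mulrC.
Qed.

Lemma horner_deriv_line_sum_rec S d t :
  #|S|%:R * (line_sum S d.+1)^`().[t] =
  Z S * (line_sum S d).[t] + (Y S + t * Z S) * (line_sum S d)^`().[t] +
  \sum_(v in S) (line_sum (S :\ v) d.+1)^`().[t].
Proof.
have /(congr1 (fun p => p^`().[t])) := line_sum_rec S d.
rewrite !derivE [(\sum_(v in S) _)^`()]raddf_sum !hornerE [(\sum_(v in S) _).[t]]horner_sum => ->.
ring.
Qed.

Lemma horner_deriv2_line_sum_rec S d t :
  #|S|%:R * (line_sum S d.+1)^`()^`().[t] =
  2 * Z S * (line_sum S d)^`().[t] + (Y S + t * Z S) * (line_sum S d)^`()^`().[t] +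
  \sum_(v in S) (line_sum (S :\ v) d.+1)^`()^`().[t].
Proof.
have /(congr1 (fun p => p^`()^`().[t])) := line_sum_rec S d.
rewrite !derivE 2![(\sum_(v in S) _)^`()]raddf_sum !hornerE [(\sum_(v in S) _).[t]]horner_sum => ->.
rewrite /=; ring.
Qed.

Lemma line_sum_ge0 S d t :
  (forall a, 0 <= y a + t * z a) -> 0 <= (line_sum S d).[t].
Proof.
move=> yz; rewrite horner_sum sumr_ge0 // => e _.
rewrite hornerZ horner_prod mulr_ge0 ?prodr_ge0 // => i _.
by rewrite !hornerE mulrC.
Qed.

(** Words of one edge give a polynomial of degree at most 1 in the line parameter. *)
Lemma deriv2_line_sum1 S t : (line_sum S 1)^`()^`().[t] = 0.
Proof.
elim: {S}_.+1 {-2}S (ltnSn #|S|) => // k IH S; rewrite ltnS => Sk.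
have [->|S0] := eqVneq S finset.set0.
  by rewrite /line_sum word_sum_set0 !deriv0 horner0.
have s0 : #|S|%:R != 0 :> K by rewrite pnatr_eq0 cards_eq0.
apply: (mulfI s0); rewrite horner_deriv2_line_sum_rec {1 2}/line_sum word_sum0.
rewrite derivC !deriv0 !horner0 !mulr0 !add0r big1 // => v vS.
by apply: IH; rewrite (leq_trans _ Sk) // [X in (_ < X)%N](cardsD1 v) vS.
Qed.

(* The quadratic form is [E[U^d (Z + c)^2] / d!]. The recursion lowers [d] or [S]
   at the price of a term linear in [Z + c], absorbed by shifting [c] by [Z S / #|S|]. *)
Lemma line_sum_form_ge0 S d c t :
  (forall a, 0 <= y a + t * z a) ->
  0 <= (line_sum S d.+2)^`()^`().[t] + 2 * c * (line_sum S d.+1)^`().[t] +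
       c ^+ 2 * (line_sum S d).[t].
Proof.
move=> yz.
elim: {S}_.+1 {-2}S (ltnSn #|S|) d c => // k IH S; rewrite ltnS => Sk.
have [->|S0] := eqVneq S finset.set0.
  case=> [|d] c; rewrite /line_sum ?word_sum0 !word_sum_set0 !deriv0 !horner0 ?hornerC.
    by rewrite !mulr0 !add0r mulr1 sqr_ge0.
  by rewrite !mulr0 !add0r.
have s0 : 0 < #|S|%:R :> K by rewrite ltr0n card_gt0.
have U0 : 0 <= Y S + t * Z S.
  by rewrite /Y /Z mulr_sumr -big_split sumr_ge0 // => a _; exact: yz.
have IHS d c : 0 <= \sum_(v in S) ((line_sum (S :\ v) d.+2)^`()^`().[t] +
    2 * c * (line_sum (S :\ v) d.+1)^`().[t] + c ^+ 2 * (line_sum (S :\ v) d).[t]).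
  apply: sumr_ge0 => v vS; apply: IH.
  by rewrite (leq_trans _ Sk) // [X in (_ < X)%N](cardsD1 v) vS.
(* The [Q] form keeps [S] and lowers [d], the [T] form is [IHS]; both are used at the shifted [c],
   hence the quantification over [c]. *)
elim=> [|d IHd] c.
- apply: (complete_square s0 U0) (horner_deriv2_line_sum_rec S 1 t)
    (horner_deriv_line_sum_rec S 0 t) _ (line_sum_ge0 S 0 yz) _ _.
  (* Length 0 has no predecessor: [Q0] is 0 and [T0] sums the constant 1 over [S], which gives
     [#|S|]. *)
  + instantiate (1 := \sum_(v in S) (line_sum (S :\ v) 0).[t]); instantiate (1 := 0).
    rewrite mulr0 add0r /line_sum word_sum0 hornerC mulr1.
    by under eq_bigr do rewrite word_sum0 hornerC; rewrite sumr_const.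
  + by rewrite deriv2_line_sum1 /line_sum word_sum0 derivC horner0 !mulr0 !addr0.
  + by have := IHS 0 (c + Z S / #|S|%:R); rewrite !big_split -!mulr_sumr.
apply: (complete_square s0 U0) (horner_deriv2_line_sum_rec S d.+2 t) (horner_deriv_line_sum_rec S d.+1 t)
  (horner_line_sum_rec S d t) (line_sum_ge0 S d.+1 yz) (IHd _) _.
by have := IHS d.+1 (c + Z S / #|S|%:R); rewrite !big_split -!mulr_sumr.
Qed.

End Line.

(** * From second derivatives to convexity *)

Lemma poly_convex (K : rcfType) (p : {poly K}) (t : K) :
  (forall u, 0 <= u <= 1 -> 0 <= p^`()^`().[u]) -> 0 <= t <= 1 ->
  p.[t] <= t * p.[1] + (1 - t) * p.[0].
Proof.
move=> p2 /andP[]; rewrite le_eqVlt => /predU1P[<- _|t0].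
  by rewrite mul0r add0r subr0 mul1r.
rewrite le_eqVlt => /predU1P[->|t1]; first by rewrite mul1r subrr mul0r addr0.
(* Mean values on both sides of [t], then for the derivative between them; the convexity gap is
   [t * (1 - t)] times the increase of the derivative from [a] to [b]. *)
have [a /[!in_itv]/= /andP[a0 at'] pa] := poly_mvt p t0.
have [b /[!in_itv]/= /andP[tb b1] pb] := poly_mvt p t1.
have [c /[!in_itv]/= /andP[ac cb] pc] := poly_mvt p^`() (lt_trans at' tb).
have : 0 <= p^`().[b] - p^`().[a].
  rewrite pc mulr_ge0 ?p2 //; last by lra.
  by apply/andP; split; lra.
move=> dp; rewrite -subr_ge0.
have -> : t * p.[1] + (1 - t) * p.[0] - p.[t] =
    t * (1 - t) * (p^`().[b] - p^`().[a]).
  transitivity (t * (p^`().[b] * (1 - t)) - (1 - t) * (p^`().[a] * (t - 0))); last by ring.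
  by rewrite -pa -pb; ring.
by rewrite mulr_ge0 // mulr_ge0 ?subr_ge0 // ltW.
Qed.

Lemma fd_convex (R : realType) (d n : nat) :
  convex_function (simplex R n) (fd R n d.+2).
Proof.
move=> t x y; rewrite !inE => -[x0 _] [y0 _].
pose F := line_sum y (fun a => x a - y a) [set: 'I_n]%SET d.+2.
have FE (u : R) (w : {ffun edge n -> R^o}) :
    (forall a, w a = y a + u * (x a - y a)) -> fd R n d.+2 w = F.[u].
  move=> wE; rewrite horner_sum; apply: eq_big => e; first by rewrite finset.subsetT.
  rewrite hornerZ horner_prod -big_split /= => _; apply: eq_bigr => i _.
  by rewrite wE !hornerE mulrC [u * _]mulrC.
rewrite convRE (FE 1 x); last by move=> a; rewrite mul1r addrC subrK.
rewrite (FE 0 y); last by move=> a; rewrite mul0r addr0.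
rewrite (FE t%:num); last first.
  move=> a; rewrite !ffunE [LHS]addrC /unstable.onem /GRing.scale /= mulrBl mul1r.
  by rewrite mulrBr -addrA [- _ + _]addrC.
apply: poly_convex => [u /andP[u0 u1]|]; last by rewrite ge0 le1.
(* At [c = 0] the form is the second derivative alone. *)
have := line_sum_form_ge0 (y := y) (z := fun a => x a - y a) [set: 'I_n]%SET d 0 (t := u).
rewrite mulr0 expr0n !mul0r !addr0; apply => a.
have -> : y a + u * (x a - y a) = u * x a + (1 - u) * y a by ring.
by rewrite addr_ge0 ?mulr_ge0 ?subr_ge0.
Qed.

Local Close Scope ring_scope.

Theorem theorem1p1 (R : realType) (d n : nat) (hd : 2 <= d <= 9) (hn : 2 <= n) :
  convex_function (simplex R n) (fd R n d).
Proof. by case: d hd => [|[|d]] // _; exact: fd_convex. Qed.
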